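(* Let $\alpha\ge 3$ be an integer and let $G$ be a graph on $n$ vertices with independence number $\alpha$. Define $f(3)=f(4)=2.25$ and, for $\alpha\ge 5$, $f(\alpha)=2.25+\sum_{i=6}^{\alpha+1}\frac{1}{2i}$. Then $G$ contains an immersion of a clique on at least $\left\lfloor \frac{n}{2.25\alpha-f(\alpha)}\right\rfloor-1$ vertices.
   Context: A graph $G$ contains a graph $H$ as an immersion if there is an injective map $\phi\colon V(H)\to V(G)$ such that for every edge $uv\in E(H)$ there is a path $P_{uv}$ in $G$ with endpoints $\phi(u)$ and $\phi(v)$, and the paths $P_{uv}$, $uv\in E(H)$, are pairwise edge-disjoint. The independence number of $G$ is the maximum size of a set of pairwise non-adjacent vertices. *)

(* Defs.v *)
From mathcomp Require Import all_boot all_order all_algebra.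

Set Implicit Arguments.
Unset Strict Implicit.
Unset Printing Implicit Defensive.

Import Order.TTheory GRing.Theory Num.Theory.

(* A simple graph on V is a symmetric irreflexive relation g : rel V. *)

Definition independent (V : finType) (g : rel V) (S : {set V}) : bool :=
  [forall x in S, forall y in S, ~~ g x y].

Definition independence_number (V : finType) (g : rel V) : nat :=
  \max_(S : {set V} | independent g S) #|S|.

(* As in MathComp's path library, a path is given by its first vertex x and
   the sequence p of its remaining vertices; uniq excludes repetitions. *)
Definition path_between (V : finType) (g : rel V) (x y : V) (p : seq V) : bool :=
  [&& path g x p, last x p == y & uniq (x :: p)].

Definition path_edges (V : finType) (x : V) (p : seq V) : {set {set V}} :=
  [set E in pairmap (fun a b => [set a; b]) x p].

(* Edges of h are unordered: P u v and P v u are two choices for the same edge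
   uv, so disjointness is only required for distinct sets [set u; v]. The two
   choices may be taken to be reverses of each other. *)
Definition immersion (U V : finType) (h : rel U) (g : rel V) : Prop :=
  exists (phi : U -> V) (P : U -> U -> seq V),
    [/\ injective phi,
        forall u v, h u v -> path_between g (phi u) (phi v) (P u v)
      & forall u v u' v', h u v -> h u' v' -> [set u; v] != [set u'; v'] ->
          [disjoint path_edges (phi u) (P u v)
                  & path_edges (phi u') (P u' v')]].

Definition complete_graph (k : nat) : rel 'I_k := fun i j => i != j.

Local Open Scope ring_scope.

(* Only used for 3 <= alpha; the values below 3 are irrelevant. *)
Definition f (alpha : nat) : rat :=
  if (alpha <= 4)%N then 9 / 4
  else 9 / 4 + \sum_(6 <= i < alpha.+2) 1 / (2 * i%:R).

(* Main.v *)
(* Peel off a maximum independent set I and take, by induction, a clique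
   immersion with branch set M of size k - 1 in the rest. A vertex v of I becomes
   a new branch vertex: by Menger's theorem it is joined to all of M by
   edge-disjoint paths in the bipartite graph between I and its complement,
   unless some partition I = A + B is crossed by fewer than k - 1 vertices, where
   w crosses if it has neighbours both in A and in B. All other vertices see only A
   or only B, and they induce graphs of independence number at most |A|, |B|, so
   by induction on alpha they are few. This propagates the bound
   2n >= (4 alpha - 3)(k + 1) from alpha = 2, and 2 alpha - 3/2 is at most
   9/4 alpha - f(alpha).
   For alpha = 2, if the above does not apply to any non-adjacent pair, then a
   count of degrees in the complement yields an induced 5-cycle. Remove it, and
   add two of its vertices as branch vertices, joined to M by paths of length 3
   through the removed cycle. *)
Require Import Defs.
From mathcomp Require Import all_boot all_order all_algebra zify lra.

Set Implicit Arguments.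
Unset Strict Implicit.
Unset Printing Implicit Defensive.

Import Order.TTheory GRing.Theory Num.Theory.

(** * Immersions of cliques as disjoint connected edge classes *)

Section Immersions.

Variables (V : finType) (g : rel V).
Hypotheses (gsym : symmetric g) (girr : irreflexive g).
Implicit Types (h : rel V) (M S I A Z Q : {set V}) (R : V -> rel V).

(* E [set u; v] is the subgraph from which the path joining u and v is taken. *)
Definition immersed h M : Prop :=
  exists E : {set V} -> rel V,
    [/\ forall p x y, E p x y -> h x y,
        forall p, symmetric (E p),
        forall p q x y, E p x y -> E q x y -> p = q
      & forall u v, u \in M -> v \in M -> u != v -> connect (E [set u; v]) u v].

Lemma connect_subrel (e e' : rel V) x y :
  subrel e e' -> connect e x y -> connect e' x y.
Proof. by move=> ee'; apply: connect_sub => a b /ee'; apply: connect1. Qed.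

Lemma immersed_subrel h h' M : subrel h h' -> immersed h M -> immersed h' M.
Proof. by move=> hh' [E [E1 E2 E3 E4]]; exists E; split=> // p x y /E1 /hh'. Qed.

(** The class of the pair v, m is enlarged by [R m]. New classes avoid [h0], which contains all old
    ones, so classes of distinct pairs remain disjoint. *)
Lemma immersed_add h0 h M v R :
  immersed h0 M -> subrel h0 h ->
  {in M, forall m, subrel (R m) h} ->
  {in M, forall m, symmetric (R m)} ->
  {in M, forall m x y, R m x y -> ~~ h0 x y} ->
  {in M &, forall m m' x y, R m x y -> R m' x y -> m = m'} ->
  {in M, forall m, connect (R m) v m} ->
  immersed h (v |: M).
Proof.
move=> [E [E1 E2 E3 E4]] h0h Rh Rsym Rh0 Rdisj Rconn.
exists (fun p x y => E p x y || [exists m in M, (p == [set v; m]) && R m x y]).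
have conn m : m \in M -> connect (fun x y => E [set v; m] x y ||
    [exists m' in M, ([set v; m] == [set v; m']) && R m' x y]) v m.
  move=> mM; apply: connect_subrel (Rconn m mM) => x y Rxy.
  by apply/orP; right; apply/exists_inP; exists m; rewrite ?eqxx.
have Esym p : symmetric (fun x y => E p x y ||
    [exists m in M, (p == [set v; m]) && R m x y]).
  move=> x y; rewrite E2; congr (_ || _); apply: eq_existsb => m.
  by case mM: (m \in M) => //=; rewrite Rsym.
split=> //.
- by move=> p x y /orP[/E1/h0h //|/exists_inP[m mM /andP[_ /(Rh m mM)]]].
- move=> p q x y /orP[Ep|/exists_inP[m mM /andP[/eqP-> Rm]]].
    case/orP=> [|/exists_inP[m mM /andP[_ Rm]]]; first exact: E3 Ep.
    by case/negP: (Rh0 _ mM _ _ Rm); apply: E1 Ep.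
  case/orP=> [Eq|/exists_inP[m' mM' /andP[/eqP-> Rm']]].
    by case/negP: (Rh0 _ mM _ _ Rm); apply: E1 Eq.
  by rewrite (Rdisj m m' mM mM' x y).
move=> u w; rewrite !in_setU1 => /orP[/eqP->|uM] /orP[/eqP->|wM] ne.
- by rewrite eqxx in ne.
- exact: conn.
- by rewrite setUC (sym_connect_sym (Esym _)); apply: conn.
- by apply: connect_subrel (E4 u w uM wM ne) => x y ->.
Qed.

(** A simple path is chosen inside the class of each pair; distinct pairs have disjoint classes,
    hence edge-disjoint paths. *)
Lemma immersed_complete k M :
  #|M| = k -> immersed g M -> immersion (@complete_graph k) g.
Proof.
move=> cM [E [E1 E2 E3 E4]].
pose phi (i : 'I_k) : V := enum_val (cast_ord (esym cM) i).
have phiM i : phi i \in M by apply: enum_valP.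
have phi_inj : injective phi by move=> i j /enum_val_inj /cast_ord_inj.
pose linked u v p := u != v ->
  [/\ path (E [set phi u; phi v]) (phi u) p, last (phi u) p = phi v
    & uniq (phi u :: p)].
have /fin_all_exists[P HP] u : exists Pu, forall v, linked u v (Pu v).
  apply: (@fin_all_exists _ (fun=> seq V) (linked u)) => v; rewrite /linked.
  case: (eqVneq u v) => [_|uv]; first by exists [::].
  have ne : phi u != phi v by apply: contra_neq uv => /phi_inj.
  have /connectP[p pp lp] := E4 _ _ (phiM u) (phiM v) ne.
  by case/shortenP: pp lp => p' pp' up' _ lp; exists p'.
exists phi, P; split=> // [u v uv|u v u' v' uv uv' ne].
  have [pp lp up] := HP u v uv; apply/and3P; split=> //; last exact/eqP.
  by apply: sub_path pp => x y /E1.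
(* A path edge is an unordered set, so the symmetry of the class is what covers both
   orientations. *)
have edges (p : {set V}) x s a b : path (E p) x s ->
    [set a; b] \in path_edges x s -> E p a b.
  rewrite inE; elim: s x => //= y s IHs x /andP[Exy ps].
  rewrite inE => /orP[/eqP Eab|]; last exact: IHs.
  have xab : x \in [set a; b] by rewrite Eab set21.
  have yab : y \in [set a; b] by rewrite Eab set22.
  have aab : a \in [set x; y] by rewrite -Eab set21.
  have bab : b \in [set x; y] by rewrite -Eab set22.
  move: xab yab aab bab; rewrite !in_set2.
  by do 4!case/orP=> /eqP ?; subst => //; rewrite E2.
have edges2 x (s : seq V) F : F \in path_edges x s -> exists a b, F = [set a; b].
  rewrite inE; elim: s x => //= y s IHs x.
  by rewrite inE => /orP[/eqP->|/IHs //]; exists x, y.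
apply/pred0P => F /=; apply/negP => /andP[F1 F2].
have [a [b FE]] := edges2 _ _ _ F1; rewrite FE in F1 F2.
have [p1 _ _] := HP u v uv; have [p2 _ _] := HP u' v' uv'.
have := E3 _ _ _ _ (edges _ _ _ _ _ p1 F1) (edges _ _ _ _ _ p2 F2) => Eq.
case/eqP: ne; apply: (imset_inj phi_inj); by rewrite !imsetU1 !imset_set1.
Qed.

End Immersions.

(** * Menger's theorem *)

Section Flows.

Variables (V : finType) (h : rel V) (v : V).
Hypothesis hsym : symmetric h.
Implicit Types (F : {set V * V}) (D : V -> nat) (M Z : {set V}) (R : V -> rel V).

Definition inflow F x : nat := #|[set y | (y, x) \in F]|.
Definition outflow F x : nat := #|[set y | (x, y) \in F]|.

(* The vertex x absorbs D x units of a unit-capacity flow out of v. *)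
Definition is_flow F D : Prop :=
  [/\ forall x y, (x, y) \in F -> h x y,
      forall x y, (x, y) \in F -> (y, x) \notin F
    & forall x, x != v -> inflow F x = outflow F x + D x].

Lemma inflowU1 F x y z : (x, y) \notin F ->
  inflow ((x, y) |: F) z = inflow F z + (z == y).
Proof.
move=> xyF; rewrite /inflow; case: (eqVneq z y) => [->|zy].
  have xy1 : (x \notin [set t | (t, y) \in F]) = true by rewrite inE xyF.
  rewrite addnC -[nat_of_bool true]/(nat_of_bool true) -xy1 -cardsU1; apply: eq_card => t.
  by rewrite !inE xpair_eqE eqxx andbT.
rewrite addn0; apply: eq_card => t.
by rewrite !inE xpair_eqE (negPf zy) andbF.
Qed.

Lemma outflowU1 F x y z : (x, y) \notin F ->
  outflow ((x, y) |: F) z = outflow F z + (z == x).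
Proof.
move=> xyF; rewrite /outflow; case: (eqVneq z x) => [->|zx].
  have xy1 : (y \notin [set t | (x, t) \in F]) = true by rewrite inE xyF.
  rewrite addnC -[nat_of_bool true]/(nat_of_bool true) -xy1 -cardsU1; apply: eq_card => t.
  by rewrite !inE xpair_eqE eqxx.
rewrite addn0; apply: eq_card => t.
by rewrite !inE xpair_eqE (negPf zx).
Qed.

(** Deleting an arc moves one absorbed unit from its head back to its tail. Writing the demand as a
    sum avoids truncated subtraction. *)
Lemma flow_retract F D x y : (y, x) \in F ->
  is_flow F (fun z => D z + (z == x)) ->
  is_flow (F :\ (y, x)) (fun z => D z + (z == y)).
Proof.
move=> yxF [F1 F2 F3]; split=> [a b /setD1P[_ /F1] //|a b /setD1P[_ /F2]|z zv].
  by rewrite in_setD1 => /negPf->; rewrite andbF.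
have yxF' : (y, x) \notin F :\ (y, x) by rewrite setD11.
have := inflowU1 z yxF'; have := outflowU1 z yxF'; have := F3 z zv.
by rewrite setD1K //; lia.
Qed.

(** A residual step cancels the opposite arc if there is one and otherwise adds an arc, so no two
    opposite arcs arise. Only arcs at [u] change, so the rest of a simple augmenting path stays
    residual. *)
Lemma flow_push F D u y : u != y -> h u y -> (u, y) \notin F ->
  is_flow F (fun z => D z + (z == u)) ->
  exists2 F', is_flow F' (fun z => D z + (z == y))
    & forall a b, a != u -> b != u -> ((a, b) \in F') = ((a, b) \in F).
Proof.
move=> uy huy uyF flF; case: (boolP ((y, u) \in F)) => yuF.
  exists (F :\ (y, u)); first exact: flow_retract.
  by move=> a b _ bu; rewrite in_setD1 xpair_eqE (negPf bu) andbF.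
have [F1 F2 F3] := flF; exists ((u, y) |: F); last first.
  by move=> a b au _; rewrite in_setU1 xpair_eqE (negPf au).
split=> [a b|a b|z zv].
- by rewrite in_setU1 => /orP[/eqP[-> ->] //|/F1].
- rewrite !in_setU1 !xpair_eqE => /orP[/andP[/eqP-> /eqP->]|].
    by rewrite negb_or yuF andbT eq_sym (negPf uy).
  move=> abF; rewrite negb_or F2 // andbT; apply: contra yuF.
  by case/andP=> /eqP<- /eqP<-.
- rewrite inflowU1 // outflowU1 //; have := F3 z zv; lia.
Qed.

Lemma flow_augment s : forall F D u, uniq (u :: s) ->
  path (fun x y => h x y && ((x, y) \notin F)) u s ->
  is_flow F (fun z => D z + (z == u)) ->
  exists F', is_flow F' (fun z => D z + (z == last u s)).
Proof.
elim: s => [|y s IHs] F D u; first by exists F.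
move=> Us /= /andP[/andP[huy uyF] ps] flF.
have uy : u != y by move: Us; rewrite /= inE negb_or -andbA => /andP[].
have [F' flF' eqF] := flow_push uy huy uyF flF.
apply: IHs flF'; first by case/andP: Us.
apply: (sub_in_path (P := predC1 u)) ps.
  by move=> a b; rewrite !inE => au bu /andP[-> /=]; rewrite eqF.
by apply/allP => z zs; apply: contraTneq Us => <-; rewrite cons_uniq zs.
Qed.

(* Peeling the flow arcs backwards from the points [pos m] until all of them
   have reached v. *)
Lemma flow_paths M n : forall F (pos : V -> V), #|F| = n ->
  is_flow F (fun z => #|[set m in M | pos m == z]|) ->
  exists R,
    [/\ forall m x y, R m x y -> ((x, y) \in F) || ((y, x) \in F),
        forall m, symmetric (R m),
        forall m m' x y, R m x y -> R m' x y -> m = m'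
      & {in M, forall m, connect (R m) v (pos m)}].
Proof.
elim: n => [|n IHn] F pos cF flF.
  exists (fun _ _ _ => false); split=> // m mM; rewrite -[pos m](_ : v = _) //.
  apply/eqP; rewrite eq_sym; apply: contraT => pv; have [_ _ /(_ _ pv)] := flF.
  have F0 : F = set0 by apply/eqP; rewrite -cards_eq0 cF.
  rewrite /inflow (eq_card0 (A := [set y | _])); last by move=> z; rewrite !inE F0 inE.
  move=> /esym/eqP; rewrite addn_eq0 => /andP[_].
  by rewrite cards_eq0 => /eqP/setP/(_ m); rewrite !inE mM eqxx.
case: (boolP [exists m in M, pos m != v]) => [/exists_inP[m mM pv]|]; last first.
  rewrite negb_exists_in => /forall_inP posv.
  exists (fun _ _ _ => false); split=> // m mM.
  by have := posv m mM; rewrite negbK => /eqP->.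
have [F1 F2 F3] := flF.
(* [pos m] absorbs at least the unit of [m], so by balance some arc enters it; that arc becomes the
   last edge of the path of [m]. *)
have [y yF] : exists y, (y, pos m) \in F.
  have : 0 < inflow F (pos m).
    rewrite F3 // addn_gt0; apply/orP; right; apply/card_gt0P; exists m.
    by rewrite inE mM eqxx.
  by case/card_gt0P => y; rewrite inE; exists y.
pose pos' t := if t == m then y else pos t.
pose D0 z := #|[set t in M :\ m | pos t == z]|.
have split_m (q : V -> V) z : {in M :\ m, q =1 pos} ->
    #|[set t in M | q t == z]| = D0 z + (z == q m).
  move=> qpos; rewrite (cardsD1 m) !inE mM /= eq_sym addnC; congr (_ + _).
  apply: eq_card => t; rewrite !inE; case: (eqVneq t m) => //= tm.
  by case tM: (t \in M) => //=; rewrite qpos // !inE tm.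
have flF' : is_flow F (fun z => D0 z + (z == pos m)).
  by split=> // x xv; rewrite F3 // (split_m pos).
have pos'D : {in M :\ m, pos' =1 pos}.
  by move=> t /setD1P[tm _]; rewrite /pos' (negPf tm).
have flF1 : is_flow (F :\ (y, pos m)) (fun z => #|[set t in M | pos' t == z]|).
  have [G1 G2 G3] := flow_retract yF flF'; split=> // x xv.
  by rewrite G3 // (split_m pos' x pos'D) /pos' eqxx.
have cF1 : #|F :\ (y, pos m)| = n.
  by move: cF; rewrite (cardsD1 (y, pos m)) yF => -[].
have [R [R1 R2 R3 R4]] := IHn _ _ cF1 flF1.
pose e a b := ((a == y) && (b == pos m)) || ((b == y) && (a == pos m)).
have esym : symmetric e by move=> a b; rewrite /e orbC.
(* The peeled arc is gone from the smaller flow, and its reverse was never in [F], so the edge is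
   free for [m]. *)
have eNR t a b : e a b -> ~~ R t a b.
  move=> eab; apply/negP => /R1; rewrite !in_setD1 !xpair_eqE.
  have nyF := F2 _ _ yF.
  case/orP: eab => /andP[/eqP-> /eqP->]; rewrite !eqxx (negPf nyF) /= ?andbF //.
exists (fun t a b => R t a b || (t == m) && e a b); split.
- move=> t a b /orP[/R1|/andP[_]].
    by rewrite !in_setD1 => /orP[] /andP[_ ->]; rewrite ?orbT.
  by case/orP=> /andP[/eqP-> /eqP->]; rewrite yF ?orbT.
- by move=> t a b; rewrite R2 esym.
- move=> t t' a b /orP[Rt|/andP[/eqP-> eab]] /orP[Rt'|/andP[/eqP-> eab']] //.
  + exact: R3 Rt Rt'.
  + by case/negP: (eNR t _ _ eab').
  + by case/negP: (eNR t' _ _ eab).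
- move=> t tM; have := R4 t tM; rewrite /pos'; case: eqP => [->|tm] cn.
    apply: connect_trans (connect_subrel _ cn) (connect1 _) => [a b ->|] //.
    by rewrite /e !eqxx orbT.
  by apply: connect_subrel cn => a b ->.
Qed.

Definition cut Z := [set a | [&& a.1 \in Z, a.2 \notin Z & h a.1 a.2]].

Lemma sum_inflow F Z : \sum_(x in Z) inflow F x = #|[set a in F | a.2 \in Z]|.
Proof.
rewrite -sum1_card (partition_big (fun a => a.2) (mem Z)) /=; last first.
  by move=> a; rewrite inE => /andP[].
apply: eq_bigr => x xZ; rewrite /inflow -sum1_card.
rewrite (reindex (fun y => (y, x))) /=; last first.
  exists (fun a => a.1) => [y _ //|[a b]]; rewrite inE /= => /andP[_ /eqP->] //.
by apply: eq_bigl => y; rewrite !inE xZ eqxx !andbT.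
Qed.

Lemma sum_outflow F Z : \sum_(x in Z) outflow F x = #|[set a in F | a.1 \in Z]|.
Proof.
rewrite -sum1_card (partition_big (fun a => a.1) (mem Z)) /=; last first.
  by move=> a; rewrite inE => /andP[].
apply: eq_bigr => x xZ; rewrite /outflow -sum1_card.
rewrite (reindex (fun y => (x, y))) /=; last first.
  exists (fun a => a.2) => [y _ //|[a b]]; rewrite inE /= => /andP[_ /eqP->] //.
by apply: eq_bigl => y; rewrite !inE xZ eqxx !andbT.
Qed.

(** As [Z] is closed under residual steps, every cut edge carries flow out of [Z] and no flow
    returns. Summing the balance outside [Z] equates the flow out with the number of sinks there. *)
Lemma saturated_cut F M Z : v \in Z -> is_flow F (fun z => z \in M) ->
  {in Z, forall x y, h x y -> (x, y) \notin F -> y \in Z} ->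
  #|cut Z| <= #|M :\: Z|.
Proof.
move=> vZ [F1 F2 F3] closed.
have sum_eq : \sum_(x in ~: Z) inflow F x =
    \sum_(x in ~: Z) outflow F x + #|M :\: Z|.
  have -> : #|M :\: Z| = \sum_(x in ~: Z) (x \in M).
    rewrite -sum1_card big_mkcond [RHS]big_mkcond; apply: eq_bigr => x _.
    by rewrite !inE; case: (x \in Z); case: (x \in M).
  rewrite -big_split; apply: eq_bigr => x; rewrite inE => xZ.
  by apply: F3; apply: contraNneq xZ => ->.
move: sum_eq; rewrite sum_inflow sum_outflow.
have sub1 : [set a in F | a.1 \in ~: Z] \subset [set a in F | a.2 \in ~: Z].
  apply/subsetP => -[x y]; rewrite !inE /= => /andP[xyF xZ]; rewrite xyF /=.
  apply: contra xZ => yZ; apply: closed yZ _ _ (F2 _ _ xyF).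
  by rewrite hsym; apply: F1.
rewrite -(cardsID [set a in F | a.1 \in ~: Z]) (setIidPr sub1).
move=> /addnI <-; apply: subset_leq_card; apply/subsetP => -[x y].
rewrite !inE /= => /and3P[xZ yZ hxy]; rewrite xZ yZ andbF /= andbT.
by apply: contraR yZ => xyF; apply: closed hxy xyF.
Qed.

(* The edge form of Menger's theorem for a source v and pairwise distinct unit
   sinks, by augmenting paths. *)
Lemma menger M :
  (forall Z, v \in Z -> #|M| <= #|M :&: Z| + #|cut Z|) ->
  exists R,
    [/\ forall m, subrel (R m) h,
        forall m, symmetric (R m),
        forall m m' x y, R m x y -> R m' x y -> m = m'
      & {in M, forall m, connect (R m) v m}].
Proof.
move=> cutM.
suff [F flF] : exists F, is_flow F (fun z => z \in M).
  have [F1 F2 F3] := flF.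
  have [|R [R1 R2 R3 R4]] := @flow_paths M #|F| F id erefl.
    split=> // x xv; rewrite F3 //; congr (_ + _).
    case xM: (x \in M).
      rewrite -[LHS](cards1 x) /=; apply: eq_card => t; rewrite !inE.
      by case: eqP => [->|]; rewrite ?xM ?andbF.
    apply/esym/eqP; rewrite cards_eq0; apply/eqP/setP => t; rewrite !inE.
    by apply/andP => -[tM /eqP tx]; rewrite -tx tM in xM.
  exists R; split=> // m x y /R1 /orP[/F1 //|/F1]; by rewrite hsym.
suff aug i : i <= #|M| ->
    exists F M', [/\ M' \subset M, #|M'| = i & is_flow F (fun z => z \in M')].
  have [F [M' [sM' cM' flF]]] := aug #|M| (leqnn _).
  by exists F; rewrite (_ : M = M') //; apply/esym/eqP; rewrite eqEcard sM' cM' /=.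
elim: i => [|i IHi] iM.
  exists set0, set0; rewrite sub0set cards0; split=> //.
  split=> [x y|x y|x _]; rewrite ?inE // addn0 /inflow /outflow.
  by rewrite !eq_card0 // => y; rewrite !inE.
have [F [M' [sM' cM' flF]]] := IHi (ltnW iM).
pose res x y := h x y && ((x, y) \notin F).
(* The residually reachable set: if all its sinks were already in [M'], its cut would violate the
   hypothesis. *)
pose Z := [set x | connect res v x].
have vZ : v \in Z by rewrite inE connect0.
have closed : {in Z, forall x y, h x y -> (x, y) \notin F -> y \in Z}.
  move=> x; rewrite inE => vx y hxy xyF; rewrite inE.
  by apply: connect_trans vx (connect1 _); rewrite /res hxy.
have /subsetPn[z] : ~~ (M :&: Z \subset M').
  apply: contraL iM => sMZ; rewrite -leqNgt -cM'.
  apply: leq_trans (cutM Z vZ) _; rewrite -(cardsID Z M') leq_add //.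
    by apply: subset_leq_card; rewrite subsetI sMZ subsetIr.
  exact: (saturated_cut vZ flF closed).
rewrite !inE => /andP[zM vz] zM'.
have [s ps zs] := connectP vz.
case/shortenP: ps zs => s' ps' us' _ zs'.
(* No balance is imposed at [v], so a new unit may start there for free before being pushed to
   [z]. *)
have flF' : is_flow F (fun z => ((z \in M') - (z == v))%N + (z == v)).
  have [F1 F2 F3] := flF; split=> // x xv; rewrite F3 // (negPf xv) /=; lia.
have [F' [F1 F2 F3]] := flow_augment us' ps' flF'.
exists F', (z |: M'); split.
- by rewrite subUset sub1set zM.
- by rewrite cardsU1 zM' cM'.
split=> // x xv; rewrite F3 // -zs' in_setU1 (negPf xv) subn0.
by case: (eqVneq x z) => [->|]; rewrite ?(negPf zM') // addn0.
Qed.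

End Flows.

(** * Adding one branch vertex *)

Section CliqueImmersions.

Variables (V : finType) (g : rel V).
Hypotheses (gsym : symmetric g) (girr : irreflexive g).
Implicit Types (A I J M Q S Z : {set V}) (R : V -> rel V).

Definition induced S : rel V := fun x y => [&& g x y, x \in S & y \in S].

Definition has_clique S k : Prop :=
  exists M, [/\ M \subset S, #|M| = k & immersed (induced S) M].

Definition alpha_le S a : Prop :=
  forall J, J \subset S -> independent g J -> #|J| <= a.

Lemma independentP J :
  reflect {in J &, forall x y, ~~ g x y} (independent g J).
Proof.
apply: (iffP forall_inP) => [JP x y xJ yJ|JP x xJ].
  exact: (forall_inP (JP x xJ)).
by apply/forall_inP => y; apply: JP.
Qed.

Lemma alpha_le_subset S S' a : S' \subset S -> alpha_le S a -> alpha_le S' a.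
Proof. by move=> sS aS J sJ; apply: aS; apply: subset_trans sS. Qed.

Lemma has_clique_subset S S' k : S' \subset S -> has_clique S' k -> has_clique S k.
Proof.
move=> /subsetP sS [M [sM cM iM]]; exists M; split=> //.
  by apply: subset_trans sM _; apply/subsetP.
by apply: immersed_subrel iM => x y /and3P[xy /sS xS /sS yS]; apply/and3P.
Qed.

Lemma subset_of_card Q k : k <= #|Q| -> exists2 M : {set V}, M \subset Q & #|M| = k.
Proof.
move=> kQ; exists [set x in take k (enum Q)].
  by apply/subsetP => x; rewrite inE => /mem_take; rewrite mem_enum.
rewrite cardsE (card_uniqP _) ?take_uniq ?enum_uniq //.
by rewrite size_take -cardE; case: ltngtP kQ.
Qed.

Lemma clique_has_clique S Q k : Q \subset S ->
  {in Q &, forall x y, x != y -> g x y} -> k <= #|Q| -> has_clique S k.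
Proof.
move=> sQ clQ /subset_of_card[M sM cM]; exists M; split=> //.
  exact: subset_trans sQ.
have Esym p : symmetric (fun x y => (p == [set x; y]) && induced S x y).
  by move=> x y; rewrite setUC /induced gsym [(x \in S) && _]andbC.
exists (fun p x y => (p == [set x; y]) && induced S x y); split=> //.
- by move=> p x y /andP[].
- by move=> p q x y /andP[/eqP-> _] /andP[/eqP-> _].
move=> u v uM vM uv; apply: connect1; rewrite eqxx /=.
have sMS := subset_trans sM sQ.
by rewrite /induced clQ ?(subsetP sMS) // (subsetP sM).
Qed.

Lemma has_clique0 S : has_clique S 0.
Proof. by apply: (@clique_has_clique S set0); rewrite ?sub0set // => x y; rewrite inE. Qed.

(* The vertices of [crossing S I A] can carry paths between A and I :\: A. *)
Definition crossing S I A : {set V} :=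
  [set w in S :\: I | [exists a in A, g w a] && [exists b in I :\: A, g w b]].

(** For independent [I] inside [S] and [A] inside [I] it contains [A] itself; thus the two sides and
    the crossing vertices cover [S]. *)
Definition sees_only S I A : {set V} :=
  [set w in S | (w \notin I :\: A) && [forall b in I :\: A, ~~ g w b]].

(** The old immersion lives in [S :\: I] and the new paths in the bipartite graph [h], so they share
    no edge. It remains to check the cut condition of [menger]. *)
Lemma add_vertex S I v k : I \subset S -> v \in I ->
  {in S :\: I, forall w, exists2 c, c \in I & g w c} ->
  has_clique (S :\: I) k ->
  (forall A, A \subset I -> v \in A -> A != I -> k <= #|crossing S I A|) ->
  has_clique S k.+1.
Proof.
move=> sIS vI dom [M [sM cM iM]] crossA.
pose h x y := g x y && ((x \in I) && (y \in S :\: I) || (y \in I) && (x \in S :\: I)).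
have hsym : symmetric h by move=> x y; rewrite /h gsym orbC.
have MI m : m \in M -> m \notin I by move=> /(subsetP sM); rewrite inE => /andP[].
have MS m : m \in M -> m \in S by move=> /(subsetP sM); rewrite inE => /andP[].
have [Z vZ|R [R1 R2 R3 R4]] := @menger V h v hsym M.
  (* The end of a cut edge outside [I]; exhibiting a cut edge for each vertex of a set bounds the
     cut from below. *)
  pose other (a : V * V) := if a.1 \in I then a.2 else a.1.
  have image (T : {set V}) : {in T, forall w, exists2 a, a \in cut h Z & other a = w} ->
      #|T| <= #|cut h Z|.
    move=> HT; apply: leq_trans (leq_imset_card other (cut h Z)).
    apply/subset_leq_card/subsetP => w /HT[a aZ <-]; exact: imset_f.
  (* If [Z] contains [I], each sink outside [Z] has a cut edge to a neighbour in [I]. Otherwise each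
     vertex crossing [I :&: Z] has one, on whichever side of [Z] it lies. *)
  case: (eqVneq (I :&: Z) I) => [IZ|IZ].
    rewrite -(cardsID Z M) leq_add2l; apply: image => m /setDP[mM mZ].
    have [c cI gmc] := dom m (subsetP sM m mM).
    exists (c, m); rewrite /other /= ?cI // inE /= mZ.
    have := cI; rewrite -{1}IZ inE => /andP[_ ->].
    by rewrite /h gsym gmc cI /= (subsetP sM).
  rewrite cM; apply: leq_trans (crossA (I :&: Z) _ _ IZ) _.
  - exact: subsetIl.
  - by rewrite inE vI.
  apply: leq_trans (leq_addl _ _); apply: image => w.
  rewrite inE => /and3P[wS /exists_inP[a /setIP[aI aZ] ga] /exists_inP[b]].
  rewrite !inE => /andP[bZ bI] gb; rewrite bI /= in bZ.
  have wI : w \notin I by case/setDP: wS.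
  case wZ: (w \in Z).
    exists (w, b); rewrite /other /= ?(negPf wI) // inE /= wZ bZ /h gb.
    by rewrite bI wS orbT.
  exists (a, w); rewrite /other /= ?aI // inE /= aZ wZ /h gsym ga.
  by rewrite aI wS.
exists (v |: M); split.
- by rewrite subUset sub1set (subsetP sIS) //; apply: subset_trans sM (subsetDl _ _).
- by rewrite cardsU1 cM; case: (boolP (v \in M)) => // /MI; rewrite vI.
apply: (immersed_add iM (R := R)) => //.
- by move=> x y /and3P[gxy /setDP[xS _] /setDP[yS _]]; apply/and3P.
- move=> m _ x y /R1 /andP[gxy]; rewrite /induced gxy /=.
  by case/orP=> /andP[/(subsetP sIS)-> /setDP[-> _]].
- move=> m _ x y /R1 /andP[_]; rewrite /induced !inE.
  by case/orP=> /andP[-> _]; rewrite !andbF.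
- by move=> m m' _ _; apply: R3.
Qed.

(** An independent set on this side stays independent when [I :\: A] is added, and the two are
    disjoint. *)
Lemma alpha_le_sees_only S I A a : I \subset S -> independent g I ->
  A \subset I -> #|I| = a -> alpha_le S a -> alpha_le (sees_only S I A) #|A|.
Proof.
move=> sIS /independentP indI sAI cI aS J sJ /independentP indJ.
have JP w : w \in J -> [/\ w \in S, w \notin I :\: A & {in I :\: A, forall b, ~~ g w b}].
  by move=> /(subsetP sJ); rewrite inE => /and3P[-> -> /forall_inP].
have disj : J :&: (I :\: A) = set0.
  by apply/setP => w; rewrite !inE; apply/andP => -[/JP[_]]; rewrite inE => /negPf->.
have := aS (J :|: (I :\: A)) _ _; rewrite cardsU disj cards0 subn0.
have := cardsID A I; rewrite (setIidPr sAI) cI => <-.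
rewrite leq_add2r; apply.
- rewrite subUset (subset_trans (subsetDl _ _) sIS) andbT.
  by apply/subsetP => w /JP[].
- apply/independentP => x y; rewrite !in_setU => /orP[xJ|xI] /orP[yJ|yI].
  + exact: indJ.
  + by have [_ _] := JP x xJ; apply.
  + by rewrite gsym; have [_ _] := JP y yJ; apply.
  + by apply: indI; [case/setDP: xI|case/setDP: yI].
Qed.

Lemma dominating_independent S I w : independent g I -> I \subset S ->
  alpha_le S #|I| -> w \in S :\: I -> exists2 c, c \in I & g w c.
Proof.
move=> /independentP indI sIS aS /setDP[wS wI].
apply/exists_inP; apply: contraT; rewrite negb_exists_in => /forall_inP nw.
have := aS (w |: I) _ _; rewrite cardsU1 wI ltnn; apply.
- by rewrite subUset sub1set wS.
- apply/independentP => x y; rewrite !in_setU1.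
  move=> /orP[/eqP->|xI] /orP[/eqP->|yI]; rewrite ?girr ?nw //; last exact: indI.
  by rewrite gsym nw.
Qed.

Lemma card_crossing S I A : {in S :\: I, forall w, exists2 c, c \in I & g w c} ->
  independent g I -> A \subset I ->
  #|S| <= #|sees_only S I A| + #|sees_only S I (I :\: A)| + #|crossing S I A|.
Proof.
move=> dom /independentP indI sAI.
have DD : I :\: (I :\: A) = A by rewrite setDDr setDv set0U (setIidPr sAI).
apply: leq_trans (leq_trans (leq_card_setU _ _) (leq_add (leq_card_setU _ _) (leqnn _))).
apply: subset_leq_card; apply/subsetP => x xS; rewrite !in_setU.
case: (boolP (x \in I)) => [xI|xI].
  case: (boolP (x \in A)) => xA; apply/orP; left; apply/orP; [left|right].
    rewrite inE xS !inE xA /=; apply/forall_inP => b /setDP[bI _]; exact: indI.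
  rewrite inE xS DD xA /=; apply/forall_inP => b bA.
  by apply: indI => //; apply: (subsetP sAI).
have xSI : x \in S :\: I by rewrite inE xI.
rewrite /crossing [_ \in [set w in _ | _]]inE xSI /=.
case: (boolP [exists a in A, g x a]) => [_|] /=; last first.
  rewrite negb_exists_in => nA; rewrite [x \in sees_only _ _ (_ :\: _)]inE.
  by rewrite xS DD nA andbT (contra (subsetP sAI x)) ?orbT.
case: (boolP [exists a in I :\: A, g x a]); rewrite ?orbT //.
rewrite negb_exists_in => nA; rewrite inE xS nA andbT inE (negPf xI) andbF //.
Qed.

End CliqueImmersions.

(** * Independence number two *)

(** Cyclic distances 1 and 3 are forbidden, and three positions modulo 7 cannot be pairwise at
    distance 2. *)
Lemma seven_cycle_bits (b0 b1 b2 b3 b4 b5 b6 : bool) :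
  [&& ~~ (b0 && b1), ~~ (b1 && b2), ~~ (b2 && b3), ~~ (b3 && b4), ~~ (b4 && b5),
      ~~ (b5 && b6) & ~~ (b6 && b0)] ->
  [&& ~~ (b0 && b3), ~~ (b1 && b4), ~~ (b2 && b5), ~~ (b3 && b6), ~~ (b4 && b0),
      ~~ (b5 && b1) & ~~ (b6 && b2)] ->
  b0 + b1 + b2 + b3 + b4 + b5 + b6 <= 2.
Proof. by case: b0 b1 b2 b3 b4 b5 b6 => [] [] [] [] [] [] []. Qed.

Section FiveCycle.

Variables (V : finType) (H : rel V) (S : {set V}) (k : nat).
Hypothesis Hsym : symmetric H.
Hypothesis triangle_free :
  {in S & &, forall x y z, H x y -> H y z -> H z x -> False}.

Let N x : {set V} := [set y in S | H x y].
Let N2 x : {set V} := [set z in S | [exists b in S, H x b && H b z]].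

Hypothesis small_independent :
  forall Q : {set V}, Q \subset S -> {in Q &, forall x y, ~~ H x y} -> #|Q| < k.
(** In the application [H] is the complement graph, and this says that few vertices cross a
    non-adjacent pair. *)
Hypothesis large_degree_sum :
  {in S &, forall x y, H x y -> #|S| + 2 <= #|N x| + #|N y| + k}.
Hypothesis large_S : 5 * k.+1 <= 2 * #|S|.

(* Without closed walks of length 5, S is covered by two independent sets or
   has a closed walk of length 7. In the latter case each vertex has at most
   two neighbours on this walk, which contradicts the degree sums. *)
Lemma exists_five_cycle :
  exists v0 v1 v2 v3 v4, [/\ v0 \in S, v1 \in S, v2 \in S, v3 \in S & v4 \in S]
    /\ [/\ H v0 v1, H v1 v2, H v2 v3, H v3 v4 & H v4 v0].
Proof.
case: (boolP [exists v0 in S, exists v1 in S, exists v2 in S, exists v3 in S,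
  exists v4 in S, [&& H v0 v1, H v1 v2, H v2 v3, H v3 v4 & H v4 v0]]).
  case/exists_inP=> v0 ? /exists_inP[v1 ?] /exists_inP[v2 ?] /exists_inP[v3 ?].
  by case/exists_inP=> v4 ? /and5P[*]; exists v0, v1, v2, v3, v4.
move=> none; exfalso.
have no5 v0 v1 v2 v3 v4 : v0 \in S -> v1 \in S -> v2 \in S -> v3 \in S -> v4 \in S ->
    H v0 v1 -> H v1 v2 -> H v2 v3 -> H v3 v4 -> H v4 v0 -> False.
  move=> S0 S1 S2 S3 S4 H01 H12 H23 H34 H40; case/negP: none.
  apply/exists_inP; exists v0 => //; apply/exists_inP; exists v1 => //.
  apply/exists_inP; exists v2 => //; apply/exists_inP; exists v3 => //.
  by apply/exists_inP; exists v4 => //; apply/and5P.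
have [u [a [uS aS ua]]] : exists u a, [/\ u \in S, a \in S & H u a].
  case: (boolP [exists u in S, [exists a in S, H u a]]) => [|nedge].
    by case/exists_inP=> u uS /exists_inP[a aS ua]; exists u, a.
  suff : #|S| < k by lia.
  apply: small_independent => // x y xS yS; apply: contra nedge => xy.
  apply/exists_inP; exists x => //.
  by apply/exists_inP; exists y.
have N2P x z : z \in N2 x -> z \in S /\ exists2 b, b \in S & H x b /\ H b z.
  by rewrite inE => /andP[zS /exists_inP[b bS /andP[]]]; split=> //; exists b.
have N2I x b z : z \in S -> b \in S -> H x b -> H b z -> z \in N2 x.
  by move=> zS bS xb bz; rewrite inE zS; apply/exists_inP; exists b => //; apply/andP.
have N2_indep x : x \in S -> {in N2 x &, forall z z', ~~ H z z'}.
  move=> xS z z' /N2P[zS [b bS [xb bz]]] /N2P[z'S [b' b'S [xb' bz']]].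
  by apply/negP => zz'; apply: (no5 x b z z' b'); rewrite // Hsym.
have N2_disj x : x \in N2 u -> x \in N2 a -> False.
  move=> /N2P[xS [b bS [ub bx]]] /N2P[_ [c cS [ac cx]]].
  by apply: (no5 u b x c a); rewrite // Hsym.
have N_disj x y w : x \in S -> y \in S -> H x y -> w \in N x -> w \in N y -> False.
  rewrite !inE => xS yS xy /andP[wS xw] /andP[_ yw].
  by apply: (triangle_free xS yS wS); rewrite // Hsym.
have N_small x : x \in S -> #|N x| < k.
  move=> xS; apply: small_independent => [|y z].
    by apply/subsetP => y; rewrite inE => /andP[].
  rewrite !inE => /andP[yS xy] /andP[zS xz]; apply/negP => yz.
  by apply: (triangle_free xS yS zS); rewrite // Hsym.
have card_N x : #|N x| = \sum_(w in S) H x w.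
  rewrite -sum1_card big_mkcond [RHS]big_mkcond; apply: eq_bigr => w _.
  by rewrite inE; case: (w \in S); case: (H x w).
(* An edge inside [C] would have, together with [u a], four pairwise disjoint neighbourhoods, too
   many for the degree sums. *)
pose C := S :\: (N2 u :|: N2 a).
have C_P x : x \in C -> [/\ x \in S, x \notin N2 u & x \notin N2 a].
  by move=> /setDP[xS]; rewrite in_setU negb_or => /andP[].
have C_indep : {in C &, forall x y, ~~ H x y}.
  move=> x y /C_P[xS xu xa] /C_P[yS yu ya]; apply/negP => xy.
  have le1 w : w \in S -> H u w + H a w + H x w + H y w <= 1.
    move=> wS.
    have ua' : ~~ (H u w && H a w).
      by apply/negP => /andP[uw aw]; apply: (triangle_free uS aS wS); rewrite // Hsym.
    have xy' : ~~ (H x w && H y w).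
      by apply/negP => /andP[xw yw]; apply: (triangle_free xS yS wS); rewrite // Hsym.
    have n2 t z : z \in S -> z \notin N2 t -> ~~ (H t w && H z w).
      by move=> zS nz; apply: contra nz => /andP[tw zw]; apply: (N2I _ w); rewrite // Hsym.
    move: ua' xy' (n2 u x xS xu) (n2 a x xS xa) (n2 u y yS yu) (n2 a y yS ya).
    by case: (H u w); case: (H a w); case: (H x w); case: (H y w) => //=.
  have := leq_sum (index_enum V) le1; rewrite sum1_card !big_split /= -!card_N.
  have := large_degree_sum uS aS ua; have := large_degree_sum xS yS xy.
  by move: large_S; clear; lia.
have [[x [xC [y yu xy] [y' ya xy']]]|nC] :
    (exists x, [/\ x \in C, exists2 y, y \in N2 u & H x y & exists2 y, y \in N2 a & H x y])
    \/ {in C, forall x, [exists y in N2 a, H x y] -> {in N2 u, forall y, ~~ H x y}}.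
  case: (boolP [exists x in C, [exists y in N2 u, H x y] && [exists y in N2 a, H x y]]).
    case/exists_inP=> x xC /andP[/exists_inP yu /exists_inP ya]; left.
    by exists x.
  rewrite negb_exists_in => /forall_inP nC; right=> x xC ex y yu.
  have := nC x xC; rewrite ex andbT negb_exists_in => /forall_inP; exact.
- have [xS _ _] := C_P x xC.
  have [yS [b bS [ub b_y]]] := N2P _ _ yu.
  have [y'S [c cS [ac cy']]] := N2P _ _ ya.
  (* The closed 7-walk is u, b, y, x, y', c, a. The edges ua, by, cy', xy cover it with y counted
     twice, which forces 2|S| below 5k. *)
  have le2 w : w \in S ->
      H u w + H b w + H y w + H x w + H y' w + H c w + H a w <= 2.
    move=> wS.
    have t1 p q : p \in S -> q \in S -> H p q -> ~~ (H p w && H q w).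
      move=> pS qS pq; apply/negP => /andP[pw qw].
      by apply: (triangle_free pS qS wS); rewrite // Hsym.
    have t3 p q r s : p \in S -> q \in S -> r \in S -> s \in S ->
        H p q -> H q r -> H r s -> ~~ (H p w && H s w).
      by move=> *; apply/negP => /andP[pw sw]; apply: (no5 w p q r s); rewrite // Hsym.
    have yx : H y x by rewrite Hsym.
    have yb : H y b by rewrite Hsym.
    have y'c : H y' c by rewrite Hsym.
    have ca : H c a by rewrite Hsym.
    have au : H a u by rewrite Hsym.
    apply: seven_cycle_bits; first by rewrite !t1.
    rewrite (t3 u b y x) // (t3 b y x y') // (t3 y x y' c) // (t3 x y' c a) //.
    by rewrite (t3 y' c a u) // (t3 c a u b) // (t3 a u b y).
  have := leq_sum (index_enum V) le2; rewrite sum_nat_const !big_split /= -!card_N.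
  have := large_degree_sum uS aS ua; have := large_degree_sum bS yS b_y.
  have := large_degree_sum cS y'S cy'; have := large_degree_sum xS yS xy.
  have := N_small y yS; by move: large_S; clear; lia.
(* [C] is split so that one piece joins [N2 u] and the other [N2 a]; the two resulting independent
   sets cover [S]. *)
pose ca := [set x in C | [exists y in N2 a, H x y]].
have indU (P Q : {set V}) : {in P &, forall z z', ~~ H z z'} ->
    {in Q &, forall z z', ~~ H z z'} -> {in P & Q, forall z z', ~~ H z z'} ->
    P \subset S -> Q \subset S -> #|P :|: Q| < k.
  move=> indP indQ indPQ sP sQ; apply: small_independent; first by rewrite subUset sP.
  move=> z z'; rewrite !in_setU => /orP[zP|zQ] /orP[z'P|z'Q].
  - exact: indP.
  - exact: indPQ.
  - by rewrite Hsym; apply: indPQ.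
  - exact: indQ.
have sN2 x : N2 x \subset S by apply/subsetP => z; rewrite inE => /andP[].
have sC : C \subset S := subsetDl _ _.
have sca : ca \subset C by apply/subsetP => x; rewrite inE => /andP[].
have lt1 : #|N2 u :|: ca| < k.
  apply: indU => //; [exact: N2_indep|..|exact: subset_trans sC].
    by move=> z z' /(subsetP sca) zC /(subsetP sca) z'C; apply: C_indep.
  by move=> z z' zu; rewrite inE => /andP[z'C ez']; rewrite Hsym; apply: nC z'C ez' _ zu.
have lt2 : #|N2 a :|: (C :\: ca)| < k.
  apply: indU => //; [exact: N2_indep|..|exact: subset_trans (subsetDl _ _) sC].
    by move=> z z' /setDP[zC _] /setDP[z'C _]; apply: C_indep.
  move=> z z' za /setDP[z'C]; rewrite /ca in_set z'C negb_exists_in.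
  by move=> /forall_inP/(_ z za); rewrite Hsym.
have cover : S \subset (N2 u :|: ca) :|: (N2 a :|: (C :\: ca)).
  apply/subsetP => x xS; rewrite !in_setU in_setD.
  case: (boolP (x \in N2 u)) => //= xu; case: (boolP (x \in ca)) => //= xca.
  case: (boolP (x \in N2 a)) => //= xa; by rewrite in_setD xS in_setU negb_or xu xa.
have := subset_leq_card cover; have := leq_card_setU (N2 u :|: ca) (N2 a :|: (C :\: ca)).
by case=> h _ h'; have := leq_trans h' h; move: lt1 lt2 large_S; clear; lia.
Qed.

End FiveCycle.

(** * Two branch vertices joined through a removed 5-cycle *)

Lemma injection_extending (T : finType) (A' A B' B : {set T}) :
  A' \subset A -> B' \subset B -> #|A'| <= #|B'| -> #|A| <= #|B| ->
  exists phi : T -> T, [/\ {in A &, injective phi}, {in A, forall x, phi x \in B}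
                         & {in A', forall x, phi x \in B'}].
Proof.
move=> sA sB le' le.
(* The subset is listed first, so matching equal positions sends [A'] into [B']. *)
pose s (C' C : {set T}) := enum C' ++ enum (C :\: C').
have s_mem (C' C : {set T}) x : C' \subset C -> (x \in s C' C) = (x \in C).
  move=> /subsetP sC; rewrite mem_cat !mem_enum in_setD.
  by case: (boolP (x \in C')) => // /sC.
have s_uniq (C' C : {set T}) : uniq (s C' C).
  rewrite cat_uniq !enum_uniq andbT /=; apply/hasPn => x.
  by rewrite /= !mem_enum in_setD => /andP[].
have s_size (C' C : {set T}) : C' \subset C -> size (s C' C) = #|C|.
  by move=> sC; rewrite size_cat -!cardE -(cardsID C' C) (setIidPr sC).
have idx x : x \in A -> index x (s A' A) < size (s B' B).
  move=> xA; apply: leq_trans (_ : size (s A' A) <= _); first by rewrite index_mem s_mem.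
  by rewrite !s_size.
exists (fun x => nth x (s B' B) (index x (s A' A))); split=> [x y xA yA|x xA|x xA'].
- rewrite (set_nth_default x y) ?idx // => /eqP.
  rewrite nth_uniq ?idx // => /eqP /(congr1 (nth x (s A' A))).
  by rewrite !nth_index ?s_mem.
- by rewrite -(s_mem B') // mem_nth // idx.
- have lt : index x (s A' A) < #|A'|.
    by rewrite index_cat mem_enum xA' cardE index_mem mem_enum.
  rewrite nth_cat -cardE (leq_trans lt) //.
  by rewrite -mem_enum mem_nth // -cardE (leq_trans lt).
Qed.

Section Detours.

Variables (V : finType) (u : V) (f c : V -> V).

(* The edges of the path m, c m, f m, u. *)
Definition spoke m : rel V := fun y z =>
  (y == m) && (z == c m) || (y == f m) && ((z == c m) || (z == u)).

Definition detour m : rel V := fun x y => spoke m x y || spoke m y x.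

Lemma detour_sym m : symmetric (detour m).
Proof. by move=> x y; rewrite /detour orbC. Qed.

Lemma detour_connect m : connect (detour m) u m.
Proof.
apply: (connect_trans (y := f m)).
  by apply: connect1; rewrite /detour /spoke !eqxx !orbT.
apply: (connect_trans (y := c m)); apply: connect1; rewrite /detour /spoke !eqxx ?orbT //.
Qed.

End Detours.

Section Alpha2.

Variables (V : finType) (g : rel V).
Hypotheses (gsym : symmetric g) (girr : irreflexive g).

(* The u_i form an induced 5-cycle; u0 and u1 become branch vertices. A branch
   vertex m not adjacent to u0 reaches it through some ca m among u2, u3, u4 and
   a vertex phia m outside M, and likewise for u1 with cb and phib. The
   paths can only collide at an m with ca m = cb m, or at a w = phia m = phib m'
   with ca m = cb m'. *)
Lemma add_two_vertices (S : {set V}) k u0 u1 u2 u3 u4 :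
  let X := [set u0; u1; u2; u3; u4] in
  let S0 := S :\: X in
  alpha_le g S 2 -> X \subset S -> uniq [:: u0; u1; u2; u3; u4] ->
  g u0 u1 -> ~~ g u0 u2 -> ~~ g u2 u4 -> ~~ g u4 u1 -> ~~ g u1 u3 -> ~~ g u3 u0 ->
  #|[set y in S0 | ~~ g y u0]| < k -> #|[set y in S0 | ~~ g y u1]| < k ->
  2 * #|[set y in S0 | ~~ g y u2 & ~~ g y u3]| < k ->
  2 * #|[set y in S0 | ~~ g y u3 & ~~ g y u4]| < k ->
  5 * k.+1 <= 2 * #|S0| ->
  has_clique g S0 k -> has_clique g S k.+2.
Proof.
move=> X S0 aS sXS; rewrite /= !inE !negb_or -!andbA.
case/and5P=> n01 n02 n03 n04 /and5P[n12 n13 n14 n23 /and3P[n24 n34 _]].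
move=> g01 h02 h24 h41 h13 h30 nn0 nn1 T23 T34 large [M [sM cM iM]].
have XP z : (z \in X) = [|| z == u0, z == u1, z == u2, z == u3 | z == u4].
  by rewrite !inE -!orbA.
have S0P w : (w \in S0) = (w \notin X) && (w \in S) by rewrite in_setD.
clearbody S0.
have X0 : u0 \in X by rewrite XP eqxx.
have X1 : u1 \in X by rewrite XP eqxx orbT.
have X2 : u2 \in X by rewrite XP eqxx !orbT.
have X3 : u3 \in X by rewrite XP eqxx !orbT.
have X4 : u4 \in X by rewrite XP eqxx !orbT.
have dom c d w : c \in X -> d \in X -> c != d -> ~~ g c d -> w \in S0 -> g w c || g w d.
  rewrite S0P => cX dX cd gcd /andP[wX wS]; apply: contraT; rewrite negb_or => /andP[wc wd].
  have ncw : c != w by apply: contraNneq wX => <-.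
  have ndw : d != w by apply: contraNneq wX => <-.
  have := aS [set w; c; d] _ _; rewrite -setUA cardsU1 cards2 cd !inE negb_or.
  rewrite eq_sym ncw eq_sym ndw; apply.
    by rewrite !subUset !sub1set wS !(subsetP sXS).
  apply/independentP => x y; rewrite !inE.
  by do 2!case/or3P=> /eqP->; rewrite ?girr // gsym.
have d02 w : w \in S0 -> g w u0 || g w u2 by apply: dom.
have d24 w : w \in S0 -> g w u2 || g w u4 by apply: dom.
have d41 w : w \in S0 -> g w u4 || g w u1 by apply: dom; rewrite // eq_sym.
have d13 w : w \in S0 -> g w u1 || g w u3 by apply: dom.
have d30 w : w \in S0 -> g w u3 || g w u0 by apply: dom; rewrite // eq_sym.
pose W := S0 :\: M.
pose Ma := [set m in M | ~~ g m u0]; pose Mb := [set m in M | ~~ g m u1].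
(* Candidates for [phia]. A vertex of [Ma] misses [u0], hence sees both [u2] and [u3]. *)
pose Ra := [set w in W | g w u0 && (g w u2 || g w u3)].
pose Rb := [set w in W | g w u1 && (g w u3 || g w u4)].
(* If both paths of [m] want [u3], one of them moves to [u4] or [u2]. [GA] and [GB] hold the middle
   vertices that need no move, or that cannot also serve the other new branch vertex, which makes
   the move safe. *)
pose GA := [set w in Ra | g w u2 || ~~ g w u1].
pose GB := [set w in Rb | g w u4 || ~~ g w u0].
pose M0 := Ma :&: Mb.
have leU4 (A B C D : {set V}) : #|A :|: B :|: C :|: D| <= #|A| + #|B| + #|C| + #|D|.
  apply: leq_trans (leq_card_setU _ _) _; rewrite leq_add2r.
  apply: leq_trans (leq_card_setU _ _) _; rewrite leq_add2r.
  exact: (leq_card_setU _ _).1.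
have sMa : Ma \subset M by apply/subsetP => x; rewrite inE => /andP[].
have sMb : Mb \subset M by apply/subsetP => x; rewrite inE => /andP[].
have leA : #|Ma| <= #|Ra|.
  (* The sets other than [Ra] have total size below 5k/2 - |Ma|. *)
  have cover : S0 \subset [set y in S0 | ~~ g y u0] :|: (M :\: Ma) :|: Ra
      :|: [set y in S0 | ~~ g y u2 & ~~ g y u3].
    apply/subsetP => y yS0; rewrite !in_setU /Ra /Ma /W !in_set yS0.
    by case: (y \in M); case: (g y u0); case: (g y u2); case: (g y u3).
  have := leq_trans (subset_leq_card cover) (leU4 _ _ _ _).
  rewrite cardsD (setIidPr sMa) cM; have := subset_leq_card sMa; rewrite cM.
  move: nn0 T23 large; clear; lia.
have leB : #|Mb| <= #|Rb|.
  have cover : S0 \subset [set y in S0 | ~~ g y u1] :|: (M :\: Mb) :|: Rb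
      :|: [set y in S0 | ~~ g y u3 & ~~ g y u4].
    apply/subsetP => y yS0; rewrite !in_setU /Rb /Mb /W !in_set yS0.
    by case: (y \in M); case: (g y u1); case: (g y u3); case: (g y u4).
  have := leq_trans (subset_leq_card cover) (leU4 _ _ _ _).
  rewrite cardsD (setIidPr sMb) cM; have := subset_leq_card sMb; rewrite cM.
  move: nn1 T34 large; clear; lia.
have leG : #|M0| <= #|GA| + #|GB|.
  (* A neighbour of [u0] outside [M] that misses [u1] sees [u3] and lies in [GA]; one that sees [u1]
     also sees [u2] or [u4] and lies in [GA] or [GB]. *)
  have cover : S0 \subset M :|: GA :|: GB :|: ([set y in S0 | ~~ g y u0] :\: M0).
    apply/subsetP => y yS0.
    have := d24 y yS0; have := d41 y yS0; have := d13 y yS0; have := d30 y yS0.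
    have := d02 y yS0.
    rewrite !in_setU /M0 /GA /GB /Ra /Rb /Ma /Mb /W !(in_set, in_setI, in_setD) yS0.
    by case: (y \in M); case: (g y u0); case: (g y u1); case: (g y u2); case: (g y u3);
       case: (g y u4).
  have := leq_trans (subset_leq_card cover) (leU4 _ _ _ _).
  have sM0 : M0 \subset [set y in S0 | ~~ g y u0].
    apply/subsetP => y /setIP[]; rewrite !in_set.
    by move=> /andP[/(subsetP sM)-> ->].
  rewrite cardsD (setIidPr sM0) cM; have := subset_leq_card sM0.
  move: nn0 large; clear; lia.
have [Ma' sMa' cMa'] : exists2 A : {set V}, A \subset M0 & #|A| = minn #|M0| #|GA|.
  by apply: subset_of_card; rewrite geq_minl.
have [phia [phia_inj phiaR phiaG]] : exists phi : V -> V,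
    [/\ {in Ma &, injective phi}, {in Ma, forall x, phi x \in Ra}
      & {in Ma', forall x, phi x \in GA}].
  apply: injection_extending => //; last by rewrite cMa' geq_minr.
    by apply: subset_trans sMa' (subsetIl _ _).
  by apply/subsetP => x; rewrite inE => /andP[].
have [phib [phib_inj phibR phibG]] : exists phi : V -> V,
    [/\ {in Mb &, injective phi}, {in Mb, forall x, phi x \in Rb}
      & {in M0 :\: Ma', forall x, phi x \in GB}].
  apply: injection_extending => //.
  - by apply: subset_trans (subsetDl _ _) (subsetIr _ _).
  - by apply/subsetP => x; rewrite inE => /andP[].
  - by rewrite cardsD (setIidPr sMa') cMa'; move: leG; clear; lia.
have phi0 m : m \in Ma -> m \in Mb -> [|| g (phia m) u2, ~~ g (phia m) u1,
    g (phib m) u4 | ~~ g (phib m) u0].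
  move=> ma mb; case: (boolP (m \in Ma')) => [/phiaG|nm].
    by rewrite inE => /andP[_ /orP[]->]; rewrite ?orbT.
  have /phibG : m \in M0 :\: Ma' by rewrite in_setD nm in_setI ma.
  by rewrite inE => /andP[_ /orP[]->]; rewrite ?orbT.
have RaP w : w \in Ra -> [/\ w \in S0, w \notin M, g w u0 & g w u2 || g w u3].
  by rewrite !inE => /and3P[/andP[-> ->] -> ->].
have RbP w : w \in Rb -> [/\ w \in S0, w \notin M, g w u1 & g w u3 || g w u4].
  by rewrite !inE => /and3P[/andP[-> ->] -> ->].
have MaP m : m \in M -> (m \in Ma) = ~~ g m u0 by rewrite inE => ->.
have MbP m : m \in M -> (m \in Mb) = ~~ g m u1 by rewrite inE => ->.
(* For [m] adjacent to [u0] the choices [fa m = m] and [ca m = u0] collapse the detour to a single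
   edge; similarly for [u1]. *)
pose fa m := if m \in Ma then phia m else m.
pose fb m := if m \in Mb then phib m else m.
pose ca m := if m \notin Ma then u0 else if g (phia m) u2 then u2 else
  if [&& m \in Mb, ~~ g (phib m) u4 & ~~ g (phia m) u1] then u4 else u3.
pose cb m := if m \notin Mb then u1 else if g (phib m) u4 then u4 else
  if [&& m \in Ma, ~~ g (phia m) u2 & g (phia m) u1] then u2 else u3.
have neq : ((u0 == u1) = false) * ((u0 == u2) = false) * ((u0 == u3) = false) *
    ((u0 == u4) = false) * ((u1 == u2) = false) * ((u1 == u3) = false) *
    ((u1 == u4) = false) * ((u2 == u3) = false) * ((u2 == u4) = false) *
    ((u3 == u4) = false) by do !split; apply: negbTE.
have faP m : m \in M ->
    [/\ fa m \in S0, ca m \in X, g m (ca m), g (fa m) (ca m) & g (fa m) u0].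
  move=> mM; have mS0 := subsetP sM m mM; rewrite /fa /ca.
  case: (boolP (m \in Ma)) => ma /=; last by move: ma; rewrite MaP // negbK => ma; split.
  have [wS0 _ w0 w23] := RaP _ (phiaR m ma).
  have m0 : ~~ g m u0 by rewrite -MaP.
  have m2 : g m u2 by have := d02 m mS0; rewrite (negPf m0).
  have m3 : g m u3 by have := d30 m mS0; rewrite (negPf m0) orbF.
  case: (boolP (g (phia m) u2)) => [//|w2] /=.
  case: (boolP [&& _, _ & _]) => [/and3P[mb _ _]|_]; last first.
    by split=> //; move: w23; rewrite (negPf w2).
  split=> //; last by have := d24 _ wS0; rewrite (negPf w2).
  by have := d41 m mS0; rewrite -[g m u1]negbK -MbP // mb orbF.
have fbP m : m \in M ->
    [/\ fb m \in S0, cb m \in X, g m (cb m), g (fb m) (cb m) & g (fb m) u1].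
  move=> mM; have mS0 := subsetP sM m mM; rewrite /fb /cb.
  case: (boolP (m \in Mb)) => mb /=; last by move: mb; rewrite MbP // negbK => mb; split.
  have [wS0 _ w1 w34] := RbP _ (phibR m mb).
  have m1 : ~~ g m u1 by rewrite -MbP.
  have m3 : g m u3 by have := d13 m mS0; rewrite (negPf m1).
  have m4 : g m u4 by have := d41 m mS0; rewrite (negPf m1) orbF.
  case: (boolP (g (phib m) u4)) => [//|w4] /=.
  case: (boolP [&& _, _ & _]) => [/and3P[ma _ _]|_]; last first.
    by split=> //; move: w34; rewrite (negPf w4) orbF.
  split=> //; last by have := d24 _ wS0; rewrite (negPf w4) orbF.
  by have := d02 m mS0; rewrite -[g m u0]negbK -MaP // ma.
have spokeaP m y z : m \in M -> spoke u0 fa ca m y z ->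
    if y \in M then y = m /\ z = ca m
    else [/\ y = phia m, m \in Ma & z = ca m \/ z = u0].
  move=> mM; rewrite /spoke /fa; case: (boolP (m \in Ma)) => ma.
    have [_ wM _ _] := RaP _ (phiaR m ma).
    case/orP=> /andP[/eqP-> zE]; first by rewrite mM (eqP zE).
    by rewrite (negPf wM); split=> //; case/orP: zE => /eqP; [left|right].
  have caE : ca m = u0 by rewrite /ca ma.
  by rewrite caE orbb => /orP[]/andP[/eqP-> /eqP->]; rewrite mM.
have spokebP m y z : m \in M -> spoke u1 fb cb m y z ->
    if y \in M then y = m /\ z = cb m
    else [/\ y = phib m, m \in Mb & z = cb m \/ z = u1].
  move=> mM; rewrite /spoke /fb; case: (boolP (m \in Mb)) => mb.
    have [_ wM _ _] := RbP _ (phibR m mb).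
    case/orP=> /andP[/eqP-> zE]; first by rewrite mM (eqP zE).
    by rewrite (negPf wM); split=> //; case/orP: zE => /eqP; [left|right].
  have cbE : cb m = u1 by rewrite /cb mb.
  by rewrite cbE orbb => /orP[]/andP[/eqP-> /eqP->]; rewrite mM.
have spokea_disj : {in M &, forall m m' y z,
    spoke u0 fa ca m y z -> spoke u0 fa ca m' y z -> m = m'}.
  move=> m m' mM m'M y z /(spokeaP _ _ _ mM) + /(spokeaP _ _ _ m'M).
  case: (y \in M) => [[-> _] [-> _] //|[-> ma _] [] + m'a _].
  exact: phia_inj.
have spokeb_disj : {in M &, forall m m' y z,
    spoke u1 fb cb m y z -> spoke u1 fb cb m' y z -> m = m'}.
  move=> m m' mM m'M y z /(spokebP _ _ _ mM) + /(spokebP _ _ _ m'M).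
  case: (y \in M) => [[-> _] [-> _] //|[-> ma _] [] + m'a _].
  exact: phib_inj.
have spoke_disj : {in M &, forall m m' y z,
    spoke u0 fa ca m y z -> spoke u1 fb cb m' y z -> False}.
  move=> m m' mM m'M y z /(spokeaP _ _ _ mM) + /(spokebP _ _ _ m'M).
  case: (y \in M) => [[-> ->] [<-]|].
    move/eqP; apply/negP; rewrite /ca /cb.
    case: (boolP (m \in Ma)) => ma; case: (boolP (m \in Mb)) => mb /=;
      rewrite ?neq //.
    - case: (g (phia m) u2) => /=; case: (g (phib m) u4) => /=;
        case: (g (phia m) u1) => /=; rewrite ?neq // eq_sym ?neq //.
    - rewrite eq_sym; case: (g (phia m) u2); rewrite ?neq //.
    - case: (g (phib m) u4); rewrite ?neq //.
  move=> [yE ma zE] [yE' mb zE'].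
  have [wS0 _ w0 w23] := RaP _ (phiaR m ma); rewrite -yE in wS0 w0 w23.
  have [_ _ w1 w34] := RbP _ (phibR m' mb); rewrite -yE' in w1 w34.
  (* The shared middle vertex [y] sees both [u0] and [u1], so neither path was moved at it. As [y]
     sees [u2] or [u4], they do not both use [u3]. *)
  have caE : ca m = if g y u2 then u2 else u3.
    by rewrite /ca ma /= -yE w1 !andbF.
  have cbE : cb m' = if g y u4 then u4 else u3.
    rewrite /cb mb /= -yE'; case: (boolP (g y u4)) => //= w4.
    case: (boolP [&& _, _ & _]) => // /and3P[m'a n2 n1].
    by have := phi0 m' m'a mb; rewrite -yE' n1 (negPf n2) (negPf w4) w0.
  have := d24 y wS0; move: zE zE'; rewrite caE cbE.
  by case: (g y u2); case: (g y u4) => //= -[->|->] [] /eqP; rewrite ?neq // eq_sym neq.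
have spokea_in m y z : m \in M -> spoke u0 fa ca m y z ->
    [/\ y \in S0, z \in X & g y z].
  move=> mM; have [fS cX mc fc fu] := faP m mM; rewrite /spoke.
  case/orP=> /andP[/eqP->]; first by move/eqP->; split=> //; apply: (subsetP sM).
  by case/orP=> /eqP->; split.
have spokeb_in m y z : m \in M -> spoke u1 fb cb m y z ->
    [/\ y \in S0, z \in X & g y z].
  move=> mM; have [fS cX mc fc fu] := fbP m mM; rewrite /spoke.
  case/orP=> /andP[/eqP->]; first by move/eqP->; split=> //; apply: (subsetP sM).
  by case/orP=> /eqP->; split.
have S0X y : y \in S0 -> y \in X -> False by rewrite S0P => /andP[/negP].
have S0S y : y \in S0 -> y \in S by rewrite S0P => /andP[].
have uM u : u \in X -> u \notin M.
  by move=> uX; apply/negP => /(subsetP sM) uS; apply: S0X uX.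
(* The edges spent once [u0] is a branch vertex; the paths of [u1] must avoid them. *)
pose h1 : rel V := fun x y => induced g S0 x y || [exists m in M, detour u0 fa ca m x y].
pose Rb' m : rel V := fun x y => if m == u0 then
  (x == u0) && (y == u1) || (x == u1) && (y == u0) else detour u1 fb cb m x y.
have sub_detour u f c : {in M, forall m y z, spoke u f c m y z -> [/\ y \in S0, z \in X & g y z]} ->
    {in M, forall m, subrel (detour u f c m) (induced g S)}.
  move=> sp m mM x y /orP[] /(sp m mM)[/S0S xS /(subsetP sXS) yS xy];
    apply/and3P; split=> //; by rewrite gsym.
have nS0_detour u f c : {in M, forall m y z, spoke u f c m y z -> [/\ y \in S0, z \in X & g y z]} ->
    {in M, forall m x y, detour u f c m x y -> ~~ induced g S0 x y}.
  move=> sp m mM x y dxy; apply/negP => /and3P[_ xS yS].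
  by case/orP: dxy => /(sp m mM)[_ zX _]; [apply: (S0X y)|apply: (S0X x)].
have disj_detour u f c u' f' c' (P : V -> V -> Prop) :
    {in M, forall m y z, spoke u f c m y z -> [/\ y \in S0, z \in X & g y z]} ->
    {in M, forall m y z, spoke u' f' c' m y z -> [/\ y \in S0, z \in X & g y z]} ->
    {in M &, forall m m' y z, spoke u f c m y z -> spoke u' f' c' m' y z -> P m m'} ->
    {in M &, forall m m' x y, detour u f c m x y -> detour u' f' c' m' x y -> P m m'}.
  move=> sp sp' spP m m' mM m'M x y /orP[] s1 /orP[] s2;
    have [a1 b1 _] := sp _ mM _ _ s1; have [a2 b2 _] := sp' _ m'M _ _ s2.
  - exact: spP s1 s2.
  - by case: (S0X x).
  - by case: (S0X y).
  - exact: spP s1 s2.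
have inA : {in M, forall m y z, spoke u0 fa ca m y z -> [/\ y \in S0, z \in X & g y z]}.
  by move=> m mM y z; apply: spokea_in.
have inB : {in M, forall m y z, spoke u1 fb cb m y z -> [/\ y \in S0, z \in X & g y z]}.
  by move=> m mM y z; apply: spokeb_in.
have i1 : immersed h1 (u0 |: M).
  apply: (immersed_add iM (R := detour u0 fa ca)).
  - by move=> x y; rewrite /h1 => ->.
  - move=> m mM x y dxy; apply/orP; right; apply/exists_inP; by exists m.
  - by move=> m _; apply: detour_sym.
  - exact: nS0_detour.
  - exact: (disj_detour _ _ _ _ _ _ (@eq V) inA inA spokea_disj).
  - by move=> m _; apply: detour_connect.
exists (u1 |: (u0 |: M)); split.
- rewrite !subUset !sub1set !(subsetP sXS) //=.
  by apply/subsetP => m /(subsetP sM)/S0S.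
- by rewrite !cardsU1 !in_setU1 (uM u0) // (negPf (uM u1 _)) // eq_sym !neq cM.
have Rb'E m : m \in M -> Rb' m = detour u1 fb cb m.
  by move=> mM; rewrite /Rb'; case: eqP mM => // ->; rewrite (negPf (uM u0 X0)).
have Rb'0 x y : Rb' u0 x y -> x \in X /\ y \in X.
  by rewrite /Rb' eqxx => /orP[] /andP[/eqP-> /eqP->].
have mix m x y : m \in M -> x \in X -> y \in X -> forall u f c,
    {in M, forall m y z, spoke u f c m y z -> [/\ y \in S0, z \in X & g y z]} ->
    detour u f c m x y -> False.
  move=> mM xX yX u f c sp /orP[] /(sp m mM)[yS _ _]; [exact: (S0X x)|exact: (S0X y)].
apply: (immersed_add i1 (R := Rb')).
- move=> x y /orP[/and3P[xy xS yS]|/exists_inP[m mM]]; last exact: sub_detour.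
  by apply/and3P; split=> //; apply: S0S.
- move=> m /setU1P[->|mM] x y; last by rewrite Rb'E //; apply: sub_detour.
  rewrite /Rb' eqxx /induced => /orP[] /andP[/eqP-> /eqP->];
    by rewrite ?g01 1?gsym ?g01 !(subsetP sXS).
- move=> m /setU1P[->|mM] x y; last by rewrite Rb'E // detour_sym.
  by rewrite /Rb' eqxx orbC [(y == _) && _]andbC [(y == _) && (x == _)]andbC.
- move=> m /setU1P[->|mM] x y.
    move=> /Rb'0[xX yX]; apply/negP => /orP[/and3P[_ xS _]|/exists_inP[m' mM]].
      exact: (S0X x).
    exact: (mix _ _ _ mM xX yX _ _ _ inA).
  rewrite Rb'E // => dxy; apply/negP => /orP[|/exists_inP[m' m'M] dxy'].
    by apply/negP; apply: nS0_detour dxy.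
  exact: (disj_detour _ _ _ _ _ _ (fun _ _ => False) inA inB spoke_disj _ _ m'M mM _ _ dxy' dxy).
- move=> m m' /setU1P[->|mM] /setU1P[->|m'M] x y //.
  + move=> /Rb'0[xX yX]; rewrite Rb'E // => dxy.
    by case: (mix _ _ _ m'M xX yX _ _ _ inB dxy).
  + by rewrite Rb'E // => dxy /Rb'0[xX yX]; case: (mix _ _ _ mM xX yX _ _ _ inB dxy).
  + by rewrite !Rb'E //; apply: (disj_detour _ _ _ _ _ _ (@eq V) inB inB spokeb_disj).
- move=> m /setU1P[->|mM]; last by rewrite Rb'E //; apply: detour_connect.
  by apply: connect1; rewrite /Rb' !eqxx orbT.
Qed.

End Alpha2.

(** * Inductions on the clique size and on the independence number *)

Section CliquesFromIndependence.

Variables (V : finType) (g : rel V).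
Hypotheses (gsym : symmetric g) (girr : irreflexive g).

(** The bound on 2|S| allows 5 per branch vertex: a non-adjacent pair costs 4 and gives one, a
    5-cycle costs 10 and gives two. *)
Lemma clique_of_alpha_le2 k : forall S : {set V},
  alpha_le g S 2 -> 5 * k.+1 <= 2 * #|S| -> has_clique g S k.
Proof.
have [n kn] := ubnP k; elim: n k kn => // n IHn k kn S aS large.
pose H : rel V := fun x y => (x != y) && ~~ g x y.
have Hsym : symmetric H by move=> x y; rewrite /H eq_sym gsym.
have tf : {in S & &, forall x y z, H x y -> H y z -> H z x -> False}.
  move=> x y z xS yS zS /andP[xy gxy] /andP[yz gyz] /andP[zx gzx].
  suff: false by [].
  have := aS [set x; y; z] _ _; rewrite -setUA cardsU1 cards2 yz !inE negb_or.
  rewrite xy eq_sym zx; apply; first by rewrite !subUset !sub1set xS yS.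
  apply/independentP => a b; rewrite !inE.
  by do 2!case/or3P=> /eqP->; rewrite ?girr // gsym.
case: (boolP [exists Q : {set V}, [&& Q \subset S, k <= #|Q| &
    [forall x in Q, forall y in Q, ~~ H x y]]]).
  case/existsP=> Q /and3P[sQ kQ /forall_inP clQ].
  apply: (clique_has_clique gsym sQ) kQ => x y xQ yQ xy.
  by have := forall_inP (clQ x xQ) y yQ; rewrite /H xy /= negbK.
rewrite negb_exists => /forallP noQ.
have small (Q : {set V}) : Q \subset S -> {in Q &, forall x y, ~~ H x y} -> #|Q| < k.
  move=> sQ clQ; have := noQ Q; rewrite sQ /= negb_and -ltnNge => /orP[//|/negP[]].
  by apply/forall_inP => x xQ; apply/forall_inP => y yQ; apply: clQ.
pose N x := [set y in S | H x y].
have N_small x : x \in S -> #|N x| < k.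
  move=> xS; apply: small => [|y z].
    by apply/subsetP => y; rewrite inE => /andP[].
  rewrite !inE => /andP[yS xy] /andP[zS xz]; apply/negP => yz.
  by apply: (tf x y z); rewrite // Hsym.
have cover u v : u \in S -> v \in S -> H u v ->
    #|S| <= #|N u| + #|N v| + #|crossing g S [set u; v] [set u]|.
  move=> uS vS uv.
  apply: leq_trans (leq_trans (leq_card_setU _ _) (leq_add (leq_card_setU _ _) (leqnn _))).
  apply: subset_leq_card; apply/subsetP => x xS; rewrite !in_setU ![x \in N _]inE xS /=.
  case: (boolP (H u x)) => //= ux; case: (boolP (H v x)) => //= vx.
  have nux : u != x by apply: contraNneq vx => <-; rewrite Hsym.
  have nvx : v != x by apply: contraNneq ux => <-.
  have gux : g u x by move: ux; rewrite /H nux negbK.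
  have gvx : g v x by move: vx; rewrite /H nvx negbK.
  rewrite inE in_setD xS !inE negb_or eq_sym nux eq_sym nvx /=; apply/andP; split.
    by apply/exists_inP; exists u; rewrite ?inE // gsym.
  apply/exists_inP; exists v; last by rewrite gsym.
  by rewrite !inE eqxx orbT andbT eq_sym; case/andP: uv.
case: k => [|k] in kn large noQ small N_small *; first exact: has_clique0.
case: (boolP [exists u in S, [exists v in S, H u v &&
    (k <= #|crossing g S [set u; v] [set u]|)]]).
  case/exists_inP=> u uS /exists_inP[v vS /andP[uv kcr]].
  have sI : [set u; v] \subset S by rewrite subUset !sub1set uS.
  have nuv : u != v by case/andP: uv.
  apply: (add_vertex gsym (I := [set u; v]) (v := u)) => //.
  - by rewrite !inE eqxx.
  - move=> w; apply: (dominating_independent gsym girr) => //; last by rewrite cards2 nuv.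
    have guv : ~~ g u v by case/andP: uv.
    apply/independentP => a b; rewrite !inE.
    by do 2!case/orP=> /eqP->; rewrite ?girr // gsym.
  - apply: IHn => //; first exact: alpha_le_subset (subsetDl _ _) aS.
    by move: large; rewrite cardsD (setIidPr sI) cards2 nuv; lia.
  - move=> A sA uA AI; rewrite (_ : A = [set u]) //; apply/eqP.
    rewrite eqEsubset sub1set uA andbT; apply/subsetP => x xA; rewrite inE.
    have := subsetP sA x xA; rewrite !inE => /orP[//|/eqP xv].
    case/eqP: AI; apply/eqP; rewrite eqEsubset sA subUset !sub1set uA -xv //.
rewrite negb_exists_in => /forall_inP ncr.
have degsum : {in S &, forall x y, H x y -> #|S| + 2 <= #|N x| + #|N y| + k.+1}.
  move=> x y xS yS xy; have := ncr x xS; rewrite negb_exists_in => /forall_inP/(_ y yS).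
  by rewrite xy /= -ltnNge; have := cover x y xS yS xy; clear; lia.
have [v0 [v1 [v2 [v3 [v4 [[S0 S1 S2 S3 S4] [H01 H12 H23 H34 H40]]]]]]] :=
  exists_five_cycle Hsym tf small degsum large.
case: k => [|k] in kn large noQ small N_small ncr degsum *.
  by have := ncr v0 S0; rewrite negb_exists_in => /forall_inP/(_ v1 S1); rewrite H01.
(* The cycle is usable from [w0] once two of these common non-neighbourhoods are small. *)
pose T x y := [set w in S | H w x && H w y].
have Tsym x y : T x y = T y x by apply/setP => w; rewrite !in_set [H w x && _]andbC.
have finish w0 w1 w2 w3 w4 : w0 \in S -> w1 \in S -> w2 \in S -> w3 \in S -> w4 \in S ->
    H w0 w1 -> H w1 w2 -> H w2 w3 -> H w3 w4 -> H w4 w0 ->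
    2 * #|T w4 w1| < k.+2 -> 2 * #|T w2 w4| < k.+2 -> has_clique g S k.+2.
  move=> W0 W1 W2 W3 W4 h01 h12 h23 h34 h40 T41 T24.
  (* A coincidence or an [H]-chord at distance two would close a triangle of [H], so the walk is an
     induced cycle. *)
  have chord x y z s t : x \in S -> y \in S -> z \in S -> s \in S -> t \in S ->
      H x y -> H y z -> H z s -> H s t -> H t x -> x != z /\ g x z.
    move=> xS yS zS sS tS xy yz zs st tx.
    have xz : x != z by apply: contraTneq tx => ->; apply/negP; apply: (tf z s t).
    split=> //; apply: contraT => gxz; exfalso; apply: (tf x y z) => //.
    by rewrite Hsym /H xz.
  have [n02 g02] := chord w0 w1 w2 w3 w4 W0 W1 W2 W3 W4 h01 h12 h23 h34 h40.
  have [n13 g13] := chord w1 w2 w3 w4 w0 W1 W2 W3 W4 W0 h12 h23 h34 h40 h01.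
  have [n24 g24] := chord w2 w3 w4 w0 w1 W2 W3 W4 W0 W1 h23 h34 h40 h01 h12.
  have [n30 g30] := chord w3 w4 w0 w1 w2 W3 W4 W0 W1 W2 h34 h40 h01 h12 h23.
  have [n41 g41] := chord w4 w0 w1 w2 w3 W4 W0 W1 W2 W3 h40 h01 h12 h23 h34.
  have HN x y : H x y -> x != y /\ ~~ g x y by rewrite /H => /andP.
  have [[m01 a01] [m12 a12]] := (HN _ _ h01, HN _ _ h12).
  have [[m23 a23] [m34 a34]] := (HN _ _ h23, HN _ _ h34).
  have [m40 a40] := HN _ _ h40.
  have [X XE] : exists X, X = [set w0; w3; w1; w4; w2] by eexists.
  have sX : X \subset S by rewrite XE !subUset !sub1set W0 W1 W2 W3 W4.
  have U : uniq [:: w0; w3; w1; w4; w2].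
    by rewrite /= !inE !negb_or m01 n02 m12 m34 eq_sym n30 eq_sym m40 eq_sym n13
      eq_sym m23 eq_sym n41 eq_sym n24.
  have largeSX : 5 * k.+1 <= 2 * #|S :\: X|.
    have := large; rewrite -(cardsID X S) (setIidPr sX).
    have <- : 5 = #|X|.
      rewrite XE -[5]/(size [:: w0; w3; w1; w4; w2]) -(card_uniqP U).
      by apply: eq_card => x; rewrite !inE -!orbA.
    by clear; lia.
  have [X0 X1 X2 X3 X4] : [/\ w0 \in X, w1 \in X, w2 \in X, w3 \in X & w4 \in X].
    by rewrite XE !inE !eqxx !orbT.
  have SX w x : w \in S :\: X -> x \in X -> H w x = ~~ g w x.
    by move=> /setDP[_ wX] xX; rewrite /H; case: eqP wX => // ->; rewrite xX.
  (* Two non-neighbours of [x] lie on the cycle, which lowers the bound from k+2 to k. *)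
  have nonnbr x y z : x \in X -> y \in X -> z \in X -> y != z -> H x y -> H x z ->
      #|[set w in S :\: X | ~~ g w x]| < k.
    move=> xX yX zX yz xy xz; have := N_small x (subsetP sX x xX).
    rewrite ltnS; suff : #|[set y; z] :|: [set w in S :\: X | ~~ g w x]| <= #|N x|.
      rewrite cardsU cards2 yz (_ : _ :&: _ = set0) ?cards0; first by clear; lia.
      apply/setP => w; rewrite in_set0; apply/negP => /setIP[].
      rewrite in_set2 inE => wyz /andP[/setDP[_ wX] _].
      by case/orP: wyz wX => /eqP->; rewrite ?yX ?zX.
    apply: subset_leq_card; rewrite !subUset !sub1set ![_ \in N _]inE xy xz.
    rewrite !(subsetP sX) //=; apply/subsetP => w; rewrite inE => /andP[wSX wx].
    by rewrite inE Hsym (SX w x) // wx andbT; case/setDP: wSX.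
  have pairs x y z : x \in X -> y \in X -> z \in X -> H z x -> H z y ->
      2 * #|T x y| < k.+2 -> 2 * #|[set w in S :\: X | ~~ g w x & ~~ g w y]| < k.
    move=> xX yX zX zx zy; suff : #|z |: [set w in S :\: X | ~~ g w x & ~~ g w y]| <= #|T x y|.
      by rewrite cardsU1 !in_set zX /=; clear; lia.
    apply: subset_leq_card; rewrite subUset sub1set inE zx zy (subsetP sX) //=.
    apply/subsetP => w; rewrite inE => /and3P[wSX wx wy].
    by rewrite inE !(SX w) // wx wy !andbT; case/setDP: wSX.
  apply: (add_two_vertices gsym girr (u0 := w0) (u1 := w3) (u2 := w1) (u3 := w4) (u4 := w2)) => //.
  - by rewrite -XE.
  - by rewrite gsym.
  - by rewrite -XE; apply: (nonnbr w0 w1 w4); rewrite // 1?eq_sym // Hsym.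
  - by rewrite -XE; apply: (nonnbr w3 w2 w4); rewrite // Hsym.
  - by rewrite -XE; apply: (pairs w1 w4 w0) => //; [rewrite Hsym|rewrite Tsym].
  - by rewrite -XE; apply: (pairs w4 w2 w3) => //; [rewrite Hsym|rewrite Tsym].
  - by rewrite -XE.
  - rewrite -XE; apply: IHn => //; first by move: kn; clear; lia.
    exact: alpha_le_subset (subsetDl _ _) aS.
(* Both sets lie in [N y], and a common element would form a triangle with [z x]. *)
have pairT x y z : x \in S -> y \in S -> z \in S -> H z x -> #|T x y| + #|T y z| < k.+2.
  move=> xS yS zS zx; apply: leq_ltn_trans (N_small y yS).
  rewrite -cardsUI (_ : _ :&: _ = set0) ?cards0 ?addn0.
    apply: subset_leq_card; apply/subsetP => w; rewrite !inE.
    by case/orP=> /and3P[-> h h']; rewrite Hsym.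
  apply/setP => w; rewrite !inE; apply/negP => /andP[/and3P[wS wx wy] /and3P[_ _ wz]].
  by apply: (tf w z x) => //; rewrite Hsym.
(* In the cyclic order t0, t2, t4, t1, t3 no two consecutive values are both large; as five is odd,
   some two consecutive ones are both small. *)
have := (pairT v0 v2 v4 S0 S2 S4 H40).
have := (pairT v2 v4 v1 S2 S4 S1 H12).
have := (pairT v4 v1 v3 S4 S1 S3 H34).
have := (pairT v1 v3 v0 S1 S3 S0 H01).
have := (pairT v3 v0 v2 S3 S0 S2 H23).
have f0 := finish v0 v1 v2 v3 v4 S0 S1 S2 S3 S4 H01 H12 H23 H34 H40.
have f1 := finish v1 v2 v3 v4 v0 S1 S2 S3 S4 S0 H12 H23 H34 H40 H01.
have f2 := finish v2 v3 v4 v0 v1 S2 S3 S4 S0 S1 H23 H34 H40 H01 H12.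
have f3 := finish v3 v4 v0 v1 v2 S3 S4 S0 S1 S2 H34 H40 H01 H12 H23.
have f4 := finish v4 v0 v1 v2 v3 S4 S0 S1 S2 S3 H40 H01 H12 H23 H34.
move: #|T v0 v2| #|T v2 v4| #|T v4 v1| #|T v1 v3| #|T v3 v0| f0 f1 f2 f3 f4.
move=> t0 t2 t4 t1 t3 f0 f1 f2 f3 f4 p0 p1 p2 p3 p4.
case: (ltnP (2 * t0) k.+2) => s0; case: (ltnP (2 * t1) k.+2) => s1;
case: (ltnP (2 * t2) k.+2) => s2; case: (ltnP (2 * t3) k.+2) => s3;
case: (ltnP (2 * t4) k.+2) => s4;
  first [exact: f0|exact: f1|exact: f2|exact: f3|exact: f4
        |exfalso; move: p0 p1 p2 p3 p4 s0 s1 s2 s3 s4; clear; lia].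
Qed.

(** Outer induction on [a], inner on [k]. For [a = 1] the set is a clique, so only its size
    matters. *)
Lemma clique_of_alpha_le a : forall (S : {set V}) k, 0 < a -> alpha_le g S a -> k <= #|S| ->
  (1 < a -> 4 * a * k.+1 <= 2 * #|S| + 3 * k.+1) -> has_clique g S k.
Proof.
have [n an] := ubnP a; elim: n a an => // n IHn a an S k.
elim: k S => [|k IHk] S; first by move=> *; apply: has_clique0.
case: a an IHk => [//|[|[|a']]] an IHk _ aS kS ineq.
- apply: (clique_has_clique gsym (subxx S)) kS => // x y xS yS xy; apply: contraT => gxy.
  have := aS [set x; y] _ _; rewrite cards2 xy; apply.
    by rewrite subUset !sub1set xS.
  apply/independentP => u v; rewrite !in_set2.
  by do 2!case/orP=> /eqP->; rewrite ?girr // gsym.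
- by apply: clique_of_alpha_le2 => //; have := ineq isT; lia.
have {}ineq := ineq isT; have [a aE] : exists a, a = a'.+3 by exists a'.+3.
rewrite -aE in an IHk aS ineq.
case: (boolP [exists I : {set V}, [&& I \subset S, independent g I & #|I| == a]]);
  last first.
  rewrite negb_exists => /forallP noI.
  apply: (IHn a'.+2); rewrite // ?aE in an ineq *; [by []| |by lia].
  move=> J sJ indJ; rewrite -ltnS ltn_neqAle -aE; have := noI J.
  by rewrite sJ indJ /= => -> /=; apply: aS.
case/existsP=> I /and3P[sIS indI /eqP cI].
(* The size hypotheses of the statement for this side and clique size k+1; a big side is settled by
   the outer induction. *)
pose big A := (k < #|sees_only g S I A|) &&
  ((1 < #|A|) ==> (4 * #|A| * k.+2 <= 2 * #|sees_only g S I A| + 3 * k.+2)).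
case: (boolP [exists A : {set V}, [&& A \proper I, 0 < #|A| & big A]]).
  case/existsP=> A /and3P[pA A0 /andP[b1 /implyP b2]].
  apply: (@has_clique_subset _ g _ (sees_only g S I A)).
    by apply/subsetP => x; rewrite inE => /andP[].
  have cA := proper_card pA; rewrite cI in cA.
  apply: (IHn #|A|) => //; first by lia.
  by apply: (alpha_le_sees_only gsym) aS => //; apply: proper_sub.
rewrite negb_exists => /forallP nbig.
have a3 : 2 < a by rewrite aE.
have /card_gt0P[v vI] : 0 < #|I| by rewrite cI aE.
have dom : {in S :\: I, forall w, exists2 c, c \in I & g w c}.
  by move=> w; apply: (dominating_independent gsym girr) => //; rewrite cI.
have cSI : #|S :\: I| + a = #|S| by rewrite -cI -(cardsID I S) (setIidPr sIS) addnC.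
apply: (add_vertex gsym sIS vI dom).
  apply: IHk; [by rewrite aE| |by nia|by move=> _; lia].
  exact: alpha_le_subset (subsetDl _ _) aS.
move=> A sAI vA AI.
have pA : A \proper I by rewrite properEneq AI.
have A0 : 0 < #|A| by apply/card_gt0P; exists v.
have cA := cardsID A I; rewrite (setIidPr sAI) cI in cA.
have ltA := proper_card pA; rewrite cI in ltA.
have pB : I :\: A \proper I.
  rewrite properEcard subsetDl cI /=; lia.
have := nbig A; rewrite pA A0 /= negb_and negb_imply -leqNgt -ltnNge => nA.
have := nbig (I :\: A); rewrite pB /= negb_and => nB.
have {}nB : ~~ big (I :\: A) by case/orP: nB => //; lia.
have := card_crossing dom indI sAI.
move: nB; rewrite negb_and negb_imply -leqNgt -ltnNge.
move: nA cA ltA A0 ineq.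
move: #|A| #|I :\: A| #|sees_only g _ _ _| #|sees_only g _ _ _| #|crossing g _ _ _| #|S|.
move=> p q t s c N nA cA ltA A0 ineq nB Nst.
(* A side with at most [k] vertices fails the linear bound too, so for [r > 1] only that failure
   need be treated. *)
have big2 r u : 1 < r -> u <= k -> 2 * u + 3 * k.+2 < 4 * r * k.+2 by nia.
have {}nA : (p = 1 /\ s <= k) \/ (1 < p /\ 2 * s + 3 * k.+2 < 4 * p * k.+2).
  case: (ltnP 1 p) nA => p1 /orP[] // nA; [right|right|left].
  - by split=> //; apply: big2.
  - by split.
  - by split=> //; lia.
have {}nB : (q = 1 /\ t <= k) \/ (1 < q /\ 2 * t + 3 * k.+2 < 4 * q * k.+2).
  case: (ltnP 1 q) nB => q1 /orP[] // nB; [right|right|left].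
  - by split=> //; apply: big2.
  - by split.
  - by split=> //; lia.
(* For p, q > 1, since (4p-3) + (4q-3) = (4a-3) - 3, more than 3(k+2)/2 vertices are left to cross.
   If one of p, q is 1, more than 4(k+2)/2 - k are left. *)
have expand : 4 * a * k.+2 = 4 * p * k.+2 + 4 * q * k.+2 by rewrite -cA; lia.
move: expand ineq; case: nA => -[p1 sB]; case: nB => -[q1 tB]; rewrite ?p1 ?q1; lia.
Qed.


End CliquesFromIndependence.

(** * From the linear bound to the function [f] *)

Local Open Scope ring_scope.

(** Each of the a-4 summands is at most 1/12; equality holds at a = 3. *)
Lemma f_le (a : nat) : (3 <= a)%N -> f a <= a%:R / 4 + 3 / 2.
Proof.
rewrite /f; case: ifP => [|/negbT]; rewrite -?ltnNge => a4 a3.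
  have : 3 <= a%:R :> rat by rewrite ler_nat.
  by lra.
have term i : (6 <= i < a.+2)%N -> 1 / (2 * i%:R) <= 1 / 12 :> rat.
  case/andP=> i6 _; have : 6 <= i%:R :> rat by rewrite ler_nat.
  move=> i6'; rewrite ler_pdivrMr; last by lra.
  by rewrite mulrAC ler_pdivlMr; lra.
have := ler_sum_nat term; rewrite sumr_const_nat -[_ *+ (_ - _)]mulr_natl.
have -> : (a.+2 - 6)%N = (a - 4)%N by lia.
rewrite natrB; last exact: ltnW.
have : 5 <= a%:R :> rat by rewrite ler_nat.
by lra.
Qed.

Theorem theorem1p5 (alpha : nat) (halpha : (3 <= alpha)%N)
  (V : finType) (g : rel V) (gsym : symmetric g) (girr : irreflexive g)
  (n : nat) (hn : #|V| = n) (hindep : independence_number g = alpha) :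
  exists k : nat,
    Num.floor (n%:R / (9 / 4 * alpha%:R - f alpha)) - 1 <= k%:Z
    /\ immersion (@complete_graph k) g.
Proof.

have alphaV : alpha_le g [set: V] alpha.
  move=> J _ indJ; rewrite -hindep.
  rewrite /independence_number (bigD1 J) //=; exact: leq_maxl.
have alpha3 : 3 <= alpha%:R :> rat by rewrite ler_nat.
have fa := f_le halpha.
set c := 9 / 4 * alpha%:R - f alpha.
have c_ge : 2 * alpha%:R - 3 / 2 <= c by rewrite /c; lra.
have c_gt0 : 0 < c by apply: lt_le_trans c_ge; move: alpha3; clear; lra.
have immersion_of k : has_clique g [set: V] k -> immersion (@complete_graph k) g.
  case=> M [_ cM iM]; apply: (immersed_complete cM).
  by apply: immersed_subrel iM => x y /and3P[].
(* The factor k+1 in the linear bound is the source of the final subtraction of one. *)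
have bound k : k.+1%:Z <= Num.floor (n%:R / c) -> has_clique g [set: V] k.
  rewrite floor_ge_int ler_pdivlMr // -pmulrn => kn.
  have kn' : k.+1%:R * (2 * alpha%:R - 3 / 2) <= n%:R :> rat.
    by apply: le_trans kn; rewrite ler_wpM2l.
  have kn4 : (4 * alpha * k.+1 <= 2 * n + 3 * k.+1)%N.
    rewrite -(ler_nat rat) !(natrD, natrM); move: kn'.
    move: (k.+1%:R : rat) (alpha%:R : rat) (n%:R : rat) => K A N; clear => KAN.
    by nra.
  apply: (clique_of_alpha_le gsym girr (a := alpha)) => //; rewrite ?cardsT ?hn //.
    by lia.
  by nia.
(* For a floor that is zero or negative the empty clique suffices. *)
case E: (Num.floor (n%:R / c)) => [[|k]|k].
- by exists 0%N; split=> //; apply/immersion_of/has_clique0.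
- exists k; split; first by lia.
  by apply/immersion_of/bound; rewrite E.
- exists 0%N; split; first by lia.
  exact/immersion_of/has_clique0.
Qed.
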